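(* Let $\Gamma$ be the set of possible values of a nuisance parameter $\gamma$, and let $\{f_{\beta_0,\gamma}:\gamma\in\Gamma\}$ be the densities of the data $R$ at the null value $\beta_0$ of the parameter of interest. Assume that $f_{\beta_0,\gamma}(r)$ is continuous in $\gamma$ for almost every $r$. Let $\psi$ be a real-valued test statistic. Consider an array $\gamma_{i,n}$, $1\le i\le n$, of values of the nuisance parameter, put $\Gamma_n=\{\gamma_{1,n},\dots,\gamma_{n,n}\}$, and suppose that $$\sup_{\gamma\in\Gamma}\ \min_{\gamma_{i,n}\in\Gamma_n}|\gamma-\gamma_{i,n}|\to 0\quad\text{as } n\to\infty .$$ Let $\phi_{\Gamma_n,\alpha}$ be the test which rejects the null hypothesis ($\phi_{\Gamma_n,\alpha}(r)=1$) if $\psi(r)>\kappa_{\Gamma_n,\alpha}(r)$, and does not reject ($\phi_{\Gamma_n,\alpha}(r)=0$) otherwise, where $\kappa_{\Gamma_n,\alpha}$ is the critical value function associated with $\Gamma_n$ and the level $\alpha$. Then, for any $\epsilon>0$, there exists an $n$ large enough so that $$\left|E_{\beta_0,\gamma}\,\phi_{\Gamma_n,\alpha}(R)-\alpha\right|\le\epsilon$$ for any value of $\gamma\in\Gamma$.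
   Context: $P_{\beta_0,\gamma}$ and $E_{\beta_0,\gamma}$ denote probability and expectation when the data $R$ have density $f_{\beta_0,\gamma}$ (all densities are with respect to a common measure on the sample space). Here $\beta_0$ is the fixed null value of the parameter of interest, $\gamma\in\Gamma$ is a nuisance parameter, $\alpha\in(0,1)$ is the nominal level, and $|\cdot|$ is the absolute value (or norm) on the space of $\gamma$. Critical value function: for a set $\Gamma_n=\{\gamma_1,\dots,\gamma_n\}$ of $n$ values of the nuisance parameter and a density function $f_\nu$ (the baseline density), $$\kappa_{\Gamma_n,\alpha}(r)=\sum_{i=1}^n k_i\,\frac{f_{\beta_0,\gamma_i}(r)}{f_\nu(r)},$$ where the scalars $k_1,\dots,k_n$ are chosen so that the test is similar on $\Gamma_n$, that is, $$P_{\beta_0,\gamma_i}\big(\psi(R)>\kappa_{\Gamma_n,\alpha}(R)\big)=\alpha,\qquad i=1,\dots,n.$$ The existence of such scalars is part of the setting.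
   Formalization: The set Γ of nuisance parameter values is additionally assumed compact; without this the uniform conclusion can fail, e.g. for Γ=(0,1] with f_γ the N(1/γ,1) density, f_ν Cauchy and ψ=1. *)

(* Defs.v *)
From mathcomp Require Export all_boot all_order all_algebra.
From mathcomp Require Export all_classical all_reals all_analysis.
Export Order.TTheory GRing.Theory Num.Theory.
Export numFieldNormedType.Exports.

Set Implicit Arguments.
Unset Strict Implicit.
Unset Printing Implicit Defensive.

Local Open Scope classical_set_scope.
Local Open Scope ring_scope.

Section definitions.
Context {d : measure_display} {T : measurableType d} {R : realType}.

Definition is_density (mu : {measure set T -> \bar R}) (f : T -> R) : Prop :=
  [/\ measurable_fun setT f, (forall r, 0 <= f r)
    & (\int[mu]_r (f r)%:E = 1)%E].

Definition has_density (mu : {measure set T -> \bar R}) (P : probability T R)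
    (f : T -> R) : Prop :=
  is_density mu f /\
  forall A, measurable A -> (P A = \int[mu]_(r in A) (f r)%:E)%E.

(* The family [f] stands for the densities at the fixed null value beta_0, so
   that only the nuisance parameter is an argument.  At points where the
   baseline density vanishes the quotient is 0, by the convention x / 0 = 0. *)
Definition critical_value {V : Type} (f : V -> T -> R) (fnu : T -> R) (n : nat)
    (g : 'I_n -> V) (k : 'I_n -> R) (r : T) : R :=
  \sum_(i < n) k i * (f (g i) r / fnu r).

Definition cv_test (psi kappa : T -> R) (r : T) : R :=
  if kappa r < psi r then 1 else 0.

Definition similar_on {V : Type} (P : V -> probability T R)
    (psi kappa : T -> R) (alpha : R) (n : nat) (g : 'I_n -> V) : Prop :=
  forall i : 'I_n, P (g i) [set r | kappa r < psi r] = alpha%:E.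

End definitions.

(* Extended-real valued: the supremum may be infinite, and the minimum over an
   empty set of points (n = 0) is +oo. *)
Definition grid_gap {R : realType} {V : normedModType R} (Gamma : set V)
    (n : nat) (g : 'I_n -> V) : \bar R :=
  ereal_sup
    [set \big[mine/+oo%E]_(i < n) (`|gamma - g i|%:E) | gamma in Gamma].

(* Main.v *)
(* By Scheffe's argument, continuity of the densities in gamma makes gamma |->
   P_gamma A continuous uniformly over measurable sets A, so the data-dependent
   rejection regions may vary with n.  A near-covering of the compact set Gamma
   turns this into a mesh size below which every gamma is close in total
   variation to a grid point, where the rejection probability is exactly alpha. *)

Require Import Defs.
From mathcomp Require Import measurable_realfun lra.

Local Open Scope classical_set_scope.
Local Open Scope ring_scope.

Set Implicit Arguments.
Unset Strict Implicit.

(** Inversion is continuous on the open set of nonzero reals; the point 0, where continuity fails,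
    is a measurable set of its own. *)
Lemma measurable_invr (R : realType) : measurable_fun setT (@GRing.inv R).
Proof.
rewrite -(setUv [set (0 : R)]); apply/measurable_funU => //.
  exact: measurableC.
split; first exact: measurable_fun_set1.
apply: open_continuous_measurable_fun.
  by apply: closed_openC; exact: closed_eq.
move=> x; rewrite inE /= => /eqP x0; exact: inv_continuous.
Qed.

Lemma measurable_critical_value (R : realType) (d : measure_display)
  (T : measurableType d) (V : Type) (f : V -> T -> R) (fnu : T -> R)
  (n : nat) (g : 'I_n -> V) (k : 'I_n -> R) :
  (forall i, measurable_fun setT (f (g i))) -> measurable_fun setT fnu ->
  measurable_fun setT (critical_value f fnu g k).
Proof.
move=> mf mfnu; apply: measurable_sum => i.
apply: measurable_funM => //; apply: measurable_funM => //.
exact: (measurableT_comp (@measurable_invr R)).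
Qed.

Lemma measurable_ltr_set (R : realType) (d : measure_display)
  (T : measurableType d) (u v : T -> R) :
  measurable_fun setT u -> measurable_fun setT v ->
  measurable [set r | u r < v r].
Proof.
move=> mu mv; rewrite -[X in measurable X]setTI.
have := measurable_fun_ltr mu mv.
by move=> /(_ measurableT [set true] I).
Qed.

Lemma expectation_cv_test (R : realType) (d : measure_display)
  (T : measurableType d) (P : probability T R) (psi kappa : T -> R) :
  measurable [set r | kappa r < psi r] ->
  ('E_P[cv_test psi kappa])%E = P [set r | kappa r < psi r].
Proof.
move=> mA; rewrite -expectation_indic //; congr (expectation P _).
apply/funext => r; rewrite /cv_test indicE.
by case: ifPn => h; [rewrite mem_set|rewrite memNset //; exact/negP].
Qed.

Lemma cvg_ereal_lt (R : realType) (u : nat -> \bar R) (l a : \bar R) :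
  u n @[n --> \oo] --> l -> (l < a)%E -> \forall n \near \oo, (u n < a)%E.
Proof.
by move=> ul la; exact: (ul _ (open_ereal_lt' la)).
Qed.

(** If every grid point were at distance at least [delta] from [gamma], so would be the minimum, and
    the supremum bounds that minimum from above. *)
Lemma grid_gap_lt (R : realType) (V : normedModType R) (Gamma : set V)
  (n : nat) (g : 'I_n -> V) (delta : R) (gamma : V) :
  Gamma gamma -> (grid_gap Gamma g < delta%:E)%E ->
  exists i, `|gamma - g i| < delta.
Proof.
move=> Ggamma gap; apply: contrapT => /forallNP far.
suff : (delta%:E <= grid_gap Gamma g)%E by rewrite leNgt gap.
apply: (@le_trans _ _ (\big[mine/+oo%E]_(i < n) (`|gamma - g i|%:E)%E)).
  (* The empty minimum is [+oo], so the bound also covers [n = 0]. *)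
  elim/big_ind: _ => [|x y|i _]; first exact: leey.
    by rewrite le_min => -> ->.
  by rewrite lee_fin leNgt; exact/negP.
by apply: ereal_sup_ubound; exists gamma.
Qed.

Section total_variation.
Context {d : measure_display} {T : measurableType d} {R : realType}.
Variable mu : {measure set T -> \bar R}.
Implicit Types (P Q : probability T R) (p q : T -> R).

(** For two probability densities this is the total variation distance. The one-sided form is
    dominated by [p] alone when [q] is nonnegative. *)
Definition excess p q : \bar R := (\int[mu]_r (Num.max (p r - q r) 0)%:E)%E.

Lemma measurable_excess p q : measurable_fun setT p -> measurable_fun setT q ->
  measurable_fun setT (fun r => (Num.max (p r - q r) 0)%:E).
Proof.
move=> mp mq; apply/measurable_EFinP.
by apply: measurable_maxr => //; exact: measurable_funB.
Qed.

(** Integrate [p <= q + max (p - q) 0] over [A], then enlarge the domain of the last, nonnegative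
    term to the whole space. *)
Lemma probability_le_excess P Q p q (A : set T) :
  has_density mu P p -> has_density mu Q q -> measurable A ->
  (P A <= Q A + excess p q)%E.
Proof.
move=> [[mp p0 _] Pp] [[mq q0 _] Qq] mA; rewrite Pp // Qq //.
have mpE : measurable_fun A (EFin \o p).
  by apply/measurable_EFinP; exact: measurable_funTS.
have mqE : measurable_fun A (EFin \o q).
  by apply/measurable_EFinP; exact: measurable_funTS.
have mE := measurable_excess mp mq.
have mEA : measurable_fun A (fun r => (Num.max (p r - q r) 0)%:E).
  exact: measurable_funTS.
have E0 r : (0 <= (Num.max (p r - q r) 0)%:E)%E.
  by rewrite lee_fin le_max lexx orbT.
apply: (@le_trans _ _ (\int[mu]_(r in A)
    ((q r)%:E + (Num.max (p r - q r) 0)%:E))%E).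
  apply: ge0_le_integral => //.
  - by move=> r _; rewrite lee_fin.
  - exact: emeasurable_funD.
  - move=> r _; rewrite -EFinD lee_fin -lerBlDl le_max lexx //.
rewrite ge0_integralD //; last by move=> r _; rewrite lee_fin.
by rewrite leeD2l //; apply: ge0_subset_integral.
Qed.

(** The one-sided bound for the complement of [A] is the missing lower bound, because both total
    masses are 1; [excess q p] never enters. *)
Lemma probability_dist_excess P Q p q (A : set T) :
  has_density mu P p -> has_density mu Q q -> measurable A ->
  (`| P A - Q A | <= excess p q)%E.
Proof.
move=> hP hQ mA.
have := probability_le_excess hP hQ mA.
have := probability_le_excess hP hQ (measurableC mA).
rewrite !probability_setC //.
rewrite -(fineK (fin_num_measure P _ mA)) -(fineK (fin_num_measure Q _ mA)).
case: (excess p q) => [e| |] //.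
  rewrite -!(EFinB, EFinD) abse_EFin !lee_fin ler_norml => h1 h2.
  by apply/andP; split; lra.
by move=> _ _; exact: leey.
Qed.

(* Scheffe: [max (p - q_ n) 0] is dominated by [p]. *)
Lemma excess_cvg0 p (q_ : nat -> T -> R) :
  is_density mu p -> (forall n, is_density mu (q_ n)) ->
  {ae mu, forall r, q_ n r @[n --> \oo] --> p r} ->
  excess p (q_ n) @[n --> \oo] --> (0 : \bar R).
Proof.
move=> [mp p0 ip] dq q_p.
rewrite -(@integral0 _ _ _ mu setT).
pose F n r := (Num.max (p r - q_ n r) 0)%:E.
have mF n : measurable_fun setT (F n).
  by apply: measurable_excess => //; have [] := dq n.
have ipE : mu.-integrable setT (EFin \o p).
  apply/integrableP; split; first exact/measurable_EFinP.
  under eq_integral => r _ do rewrite /= ger0_norm //.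
  by rewrite ip ltry.
have [] // := @dominated_convergence _ _ _ mu _ measurableT F (cst 0%E)
  (EFin \o p) mF _ _ ipE.
(* Pointwise limit: [max (p - q_ n) 0] is at most the absolute value of [p - q_ n]. *)
- apply: filterS q_p => r qr _; apply: cvg_EFin; first exact: nearW.
  apply/cvgrPdist_lt => e e0.
  move/cvgrPdist_lt: qr => /(_ _ e0); apply: filterS => n /=.
  rewrite sub0r normrN; apply: le_lt_trans.
  rewrite ger0_norm ?le_max ?lexx ?orbT // ge_max normr_ge0 andbT.
  exact: ler_norm.
- apply: aeW => r n _.
  have [_ q0 _] := dq n.
  rewrite /F /= lee_fin ger0_norm ?le_max ?lexx ?orbT //.
  by rewrite ge_max p0 andbT gerBl.
Qed.

(** Scheffe's argument concerns sequences, so a failure near [x] is turned into a sequence of bad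
    points of [Gamma] converging to [x]. *)
Lemma excess_near (V : normedModType R) (Gamma : set V) (f : V -> T -> R) :
  (forall x, Gamma x -> is_density mu (f x)) ->
  {ae mu, forall r, {within Gamma, continuous (fun x => f x r)}} ->
  forall x (e : R), Gamma x -> 0 < e ->
  \forall y \near within Gamma (nbhs x), (excess (f x) (f y) < e%:E)%E.
Proof.
move=> df fcont x e Gx e0; apply: contrapT => nnear.
have bad (m : nat) : exists y, [/\ Gamma y, ball x m.+1%:R^-1 y
    & (e%:E <= excess (f x) (f y))%E].
  apply: contrapT => /forallNP h; apply: nnear.
  apply/nbhs_ballP; exists m.+1%:R^-1; first by rewrite /= invr_gt0.
  move=> y xy Gy /=; rewrite ltNge; apply/negP => ey.
  by apply: (h y).
have [y hy] := choice bad.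
have y_x : y n @[n --> \oo] --> within Gamma (nbhs x).
  move=> A /nbhs_ballP[delta /= delta0 xA].
  change (\forall n \near \oo, A (y n)).
  near=> n; have [Gy xy _] := hy n; apply: xA => //.
  apply: le_ball xy; near: n.
  have := @cvg_harmonic R => /cvgrPdist_lt /(_ _ delta0).
  apply: filterS => n /=; rewrite sub0r normrN /harmonic /= => h.
  by apply/ltW; apply: le_lt_trans h; exact: ler_norm.
have dfy n : is_density mu (f (y n)) by have [? _ _] := hy n; exact: df.
have ex0 : excess (f x) (f (y n)) @[n --> \oo] --> (0 : \bar R).
  apply: excess_cvg0 => //; first exact: df.
  (* A single null set, outside which continuity on [Gamma] holds, serves every sequence. *)
  apply: filterS fcont => r /subspace_continuousP /(_ _ Gx) fr.
  exact: cvg_comp y_x fr.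
have e0' : (0 < e%:E)%E by rewrite lte_fin.
have [N _ /(_ N (leqnn N)) /=] := cvg_ereal_lt ex0 e0'.
by have [_ _ ey] := hy N; rewrite ltNge ey.
Unshelve. all: by end_near. Qed.

(** The neighbourhood is chosen before [A], so one neighbourhood serves the rejection regions of all
    [n]. *)
Lemma probability_near (V : normedModType R) (Gamma : set V)
  (P : V -> probability T R) (f : V -> T -> R) :
  (forall x, Gamma x -> has_density mu (P x) (f x)) ->
  {ae mu, forall r, {within Gamma, continuous (fun x => f x r)}} ->
  forall x (e : R), Gamma x -> 0 < e ->
  \forall y \near within Gamma (nbhs x), forall A, measurable A ->
    (`| P x A - P y A | <= e%:E)%E.
Proof.
move=> hf fcont x e Gx e0.
have df z : Gamma z -> is_density mu (f z) by case/hf.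
apply: filterS2 (withinT _ _) (excess_near df fcont Gx e0) => y Gy ey A mA.
exact: le_trans (probability_dist_excess (hf _ Gx) (hf _ Gy) mA) (ltW ey).
Qed.

End total_variation.

Theorem theorem1 (R : realType) (d : measure_display) (T : measurableType d)
  (mu : {measure set T -> \bar R})
  (V : normedModType R) (Gamma : set V)
  (hGamma : compact Gamma)
  (P : V -> probability T R) (f : V -> T -> R)
  (hf : forall gamma, Gamma gamma -> has_density mu (P gamma) (f gamma))
  (hcont : {ae mu, forall r, {within Gamma, continuous (fun gamma => f gamma r)}})
  (fnu : T -> R) (hfnu : is_density mu fnu)
  (psi : T -> R) (hpsi : measurable_fun setT psi)
  (alpha : R) (halpha : 0 < alpha < 1)
  (g : forall n : nat, 'I_n -> V)
  (hg : forall (n : nat) (i : 'I_n), Gamma (g n i))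
  (hgap : grid_gap Gamma (g n) @[n --> \oo] --> (0 : \bar R))
  (k : forall n : nat, 'I_n -> R)
  (hsim : forall n : nat,
     similar_on P psi (critical_value f fnu (g n) (k n)) alpha (g n))
  (epsilon : R) (hepsilon : 0 < epsilon) :
  \forall n \near \oo, forall gamma, Gamma gamma ->
    (`| 'E_(P gamma)[cv_test psi (critical_value f fnu (g n) (k n))]
        - alpha%:E | <= epsilon%:E)%E.
Proof.
pose kap n := critical_value f fnu (g n) (k n).
pose A n := [set r | kap n r < psi r].
have mA n : measurable (A n).
  apply: measurable_ltr_set => //; apply: measurable_critical_value.
    by move=> i; have [[]] := hf _ (hg n i).
  by case: hfnu.
have e20 : 0 < epsilon / 2 by rewrite divr_gt0.
(* Neighbourhoods in the near-covering are taken in [V], so membership in [Gamma] is made a premise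
   of the predicate. *)
suff : \forall n \near \oo, Gamma `<=`
    [set x | Gamma x -> (`| P x (A n) - alpha%:E | <= epsilon%:E)%E].
  apply: filterS => n h x Gx.
  by rewrite (expectation_cv_test _ (mA n)); exact: (h _ Gx Gx).
move: hGamma => /compact_near_coveringP; apply => x Gx.
have /nbhs_ballP[delta /= delta0 xP] := probability_near hf hcont Gx e20.
(* With [y] within [delta / 2] of [x] and a grid point within [delta / 2] of [y], both lie in the
   ball of radius [delta] around [x]. *)
have d20 : 0 < delta / 2 by rewrite divr_gt0.
have gap : \forall n \near \oo, (grid_gap Gamma (g n) < (delta / 2)%:E)%E.
  by apply: cvg_ereal_lt hgap _; rewrite lte_fin.
exists (ball x (delta / 2), [set n | (grid_gap Gamma (g n) < (delta / 2)%:E)%E]).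
  by split => //; exact: nbhsx_ballx.
move=> [y n] [/= xy gapn] Gy.
have [i yg] := grid_gap_lt Gy gapn.
have d2d : delta / 2 <= delta by lra.
have Py := xP y (le_ball d2d xy) Gy _ (mA n).
have Pg : (`| P x (A n) - P (g n i) (A n) | <= (epsilon / 2)%:E)%E.
  apply: xP => //; rewrite (splitr delta); apply: (ball_triangle xy).
  by rewrite -ball_normE.
(* Similarity makes the rejection probability at the grid point exactly [alpha]. *)
rewrite (hsim n i) in Pg.
move: Pg Py; rewrite -(fineK (fin_num_measure (P x) _ (mA n))).
rewrite -(fineK (fin_num_measure (P y) _ (mA n))).
rewrite -!EFinB !abse_EFin !lee_fin => Pg Py.
rewrite distrC in Py; rewrite (splitr epsilon).
(* Triangle inequality through [P x (A n)], each leg costing [epsilon / 2]. *)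
apply: le_trans _ (lerD Py Pg); rewrite -[X in `|X|](subrKA (fine (P x (A n)))).
exact: ler_normD.
Qed.
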